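(* Let $r\ge 0$ be a real number, let $p\ge 0$ be an integer with $r+p>0$, and let $x\in\mathbb{C}$ with $|x|<2$. Put $n_0=1$ if $p\ge 1$ and $n_0=0$ if $p=0$. Then $$\sum_{n=n_0}^{\infty}\binom{n+r}{n}n^{p}\left\{\zeta(n+r+1)-1\right\}x^{n}=\frac{1}{\Gamma(r+1)}\sum_{j=0}^{p}S(p,j)\,\Gamma(r+j+1)\,\zeta(r+j+1,2-x)\,x^{j}.$$ In particular, when $x=1$, $$\sum_{n=n_0}^{\infty}\binom{n+r}{n}n^{p}\left\{\zeta(n+r+1)-1\right\}=\frac{1}{\Gamma(r+1)}\sum_{j=0}^{p}S(p,j)\,\Gamma(r+j+1)\,\zeta(r+j+1),$$ and when $r=0$ (so $p\ge 1$), $$\sum_{n=1}^{\infty}n^{p}\left\{\zeta(n+1)-1\right\}x^{n}=\sum_{j=1}^{p}S(p,j)\,\Gamma(j+1)\,\zeta(j+1,2-x)\,x^{j}.$$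
   Context: $S(p,j)$ denotes the Stirling numbers of the second kind, with $S(0,0)=1$ and $S(p,0)=0$ for $p\geq 1$. $\binom{n+r}{n}=\frac{\Gamma(n+r+1)}{\Gamma(r+1)\,n!}$. The Hurwitz zeta function is $\zeta(s,a)=\sum_{k=0}^{\infty}\frac{1}{(k+a)^{s}}$ for $\mathrm{Re}\,a>0$, $\mathrm{Re}\,s>1$, and $\zeta(s)=\zeta(s,1)$ is the Riemann zeta function. Conventions: $n^0=1$ for all $n\ge 0$ and $x^0=1$. Terms with $S(p,j)=0$ are taken to be $0$ (this concerns only $j=0$, $p\ge1$, and matters when $r=0$, where $\zeta(1,2-x)$ is undefined). *)

(* Defs.v *)
From Stdlib Require Import Reals Factorial.
From Coquelicot Require Import Coquelicot.

(* Recurrence S(p+1,j+1) = (j+1) S(p,j+1) + S(p,j), with S(0,0) = 1 and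
   S(p+1,0) = S(0,j+1) = 0. *)
Fixpoint stirling2 (p j : nat) : nat :=
  match p, j with
  | O, O => 1
  | O, S _ => 0
  | S _, O => 0
  | S p', S j' => S j' * stirling2 p' (S j') + stirling2 p' j'
  end.

(* Euler's integral; meaningful for s > 0. *)
Definition Gamma (s : R) : R :=
  RInt_gen (fun t : R => (Rpower t (s - 1) * exp (- t))%R)
    (at_right 0) (Rbar_locally p_infty).

(* The generalized binomial coefficient (n + r choose n), n a natural number. *)
Definition gbinom (r : R) (n : nat) : R :=
  (Gamma (INR n + r + 1) / (Gamma (r + 1) * INR (fact n)))%R.

Definition Cexp (z : C) : C :=
  ((exp (Re z) * cos (Im z))%R, (exp (Re z) * sin (Im z))%R).

(* The principal argument, with values in (-PI, PI]; junk at z = 0. *)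
Definition Carg (z : C) : R :=
  if Rle_dec 0 (Im z) then acos (Re z / Cmod z) else (- acos (Re z / Cmod z))%R.

Definition Clog (z : C) : C := (ln (Cmod z), Carg z).

(* Principal value of z^s, for z <> 0. *)
Definition Cpower (z s : C) : C := Cexp (s * Clog z)%C.

(* Sum of a convergent complex series (junk if it diverges). *)
Definition CSeries (u : nat -> C) : C :=
  (Series (fun k => Re (u k)), Series (fun k => Im (u k))).

(* Meaningful for Re s > 1 and Re a > 0.  Outside this domain the value is an
   unspecified complex number, so that the product 0 * hurwitz_zeta s a is 0. *)
Definition hurwitz_zeta (s a : C) : C :=
  CSeries (fun k => (/ Cpower (RtoC (INR k) + a) s)%C).

Definition zeta (s : C) : C := hurwitz_zeta s (RtoC 1).

(* First index of the left-hand series: 1 if p >= 1, and 0 if p = 0. *)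
Definition first_index (p : nat) : nat :=
  match p with O => 0 | S _ => 1 end.

(* The series u_m + u_(m+1) + ... of complex numbers converges to l. *)
Definition Csums_from (m : nat) (u : nat -> C) (l : C) : Prop :=
  @is_series C_AbsRing C_NormedModule (fun n => u (m + n)%nat) l.

(* Main.v *)
Require Import Defs.
From Stdlib Require Import Reals Factorial Lra Lia.
From Coquelicot Require Import Coquelicot.

(** Expanding zeta(n+r+1) - 1 as the sum of m^-(n+r+1) over m >= 2 turns the
    left-hand side into a double series.  For p = 0 and r > 0, the sum over n
    of each fixed m is a binomial series,
<<
      sum_n (n+r choose n) (x/m)^n m^-(r+1)
        = m^-(r+1) (1 - x/m)^-(r+1) = (m - x)^-(r+1),
>>
    and summing over m = k + 2 gives zeta(r+1, 2-x).  The exchange of the two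
    sums is licit because the general term is bounded by the product
    (n+r choose n) (|x|/2)^n . m^-(r+1) of two summable sequences, thanks to
    m >= 2 and |x| < 2 ([hurwitz_zeta_expansion]).

    For general p, n^p = sum_j S(p,j) n(n-1)...(n-j+1) ([pow_stirling2]), and
    the falling factorial is absorbed by the binomial coefficient:
<<
      (n+j+r choose n+j) (n+j)! / n!
        = Gamma(r+j+1) / Gamma(r+1) (n + (r+j) choose n).
>>
    So each j contributes the case p = 0 with r + j in place of r, shifted by
    j indices ([falling_moment_series]).  The parameter r + j is positive for
    every j with S(p,j) <> 0, which is what makes r = 0 possible when p >= 1.

    Three classical facts are proved on the way.  Euler's integral satisfies
    Gamma(s+1) = s Gamma(s) and is positive; only s >= 1 matters, where the
    integrand is bounded near 0.  The binomial series is summed by a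
    differential equation: with z fixed, both t |-> sum_n (n+r choose n) (tz)^n
    and (1-tz)^-(r+1) have logarithmic derivative (r+1) z / (1-tz) on [0,1]
    ([binomial_series]).  Finally, sum m^-s converges for s > 1 by comparison
    with a telescoping series.

    Complex series are handled through their real and imaginary parts. *)

Local Open Scope R_scope.

(** * Euler's integral *)

Definition Gamma_integrand (s t : R) : R := Rpower t (s - 1) * exp (- t).

Lemma ex_derive_filterlim_at_right (g : R -> R) a l :
  ex_derive g a -> g a = l -> filterlim g (at_right a) (locally l).
Proof.
  intros H <- P HP; destruct (ex_derive_continuous g a H P HP) as [eps He].
  exists eps; intros y Hy _; now apply He.
Qed.

Lemma Gamma_integrand_pos s t : 0 < Gamma_integrand s t.
Proof. apply Rmult_lt_0_compat; apply exp_pos. Qed.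

Lemma is_derive_Rpower y t :
  0 < t -> is_derive (fun t => Rpower t y) t (y * Rpower t (y - 1)).
Proof.
  intros Ht; apply is_derive_Reals; now apply derivable_pt_lim_power.
Qed.

Lemma continuous_Gamma_integrand s t : 0 < t -> continuous (Gamma_integrand s) t.
Proof.
  intros Ht; apply (ex_derive_continuous (Gamma_integrand s)).
  apply ex_derive_mult.
  - eexists; now apply is_derive_Rpower.
  - auto_derive; trivial.
Qed.

Lemma exp_le_compat x y : x <= y -> exp x <= exp y.
Proof. intros [H| ->]; [left; now apply exp_increasing|apply Rle_refl]. Qed.

(** From ln y <= y - 1 at y = t / (2s): the power t^(s-1) costs at most
    half of the decay of exp(-t). *)
Lemma Gamma_integrand_le_exp s :
  1 <= s -> exists K, 0 < K /\
  forall t, 0 < t -> Gamma_integrand s t <= K * exp (- (t / 2)).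
Proof.
  intros Hs.
  exists (exp (- (s - 1) * (1 + ln (/ (2 * s))))); split; [apply exp_pos|].
  intros t Ht; unfold Gamma_integrand, Rpower.
  rewrite <- 2!exp_plus.
  assert (H : ln (/ (2 * s)) + ln t <= t / (2 * s) - 1).
  { assert (Hi : 0 < / (2 * s)) by (apply Rinv_0_lt_compat; lra).
    rewrite <- ln_mult by trivial.
    rewrite <- (ln_exp (t / (2 * s) - 1)).
    apply ln_le; [now apply Rmult_lt_0_compat|].
    pose proof (exp_ineq1_le (t / (2 * s) - 1)); unfold Rdiv in *; lra. }
  assert (H2 : (s - 1) * (t / (2 * s)) <= t / 2).
  { apply Rmult_le_reg_r with s; [lra|]. field_simplify; [|lra]. nra. }
  assert (H3 : (s - 1) * (ln (/ (2 * s)) + ln t) <= (s - 1) * (t / (2 * s) - 1))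
    by (apply Rmult_le_compat_l; lra).
  apply exp_le_compat; lra.
Qed.

(** The function is the antiderivative, vanishing at infinity, of the
    majorant K exp(-t/2). *)
Lemma filterlim_scal_exp_half_infty K :
  filterlim (fun t => - (2 * K) * exp (- (t / 2))) (Rbar_locally p_infty) (locally 0).
Proof.
  assert (H : is_lim (fun t => - (2 * K) * exp (- (t / 2))) p_infty (Rbar_mult (- (2 * K)) 0)).
  { apply is_lim_scal_l.
    apply is_lim_ext with (fun t => exp (- / 2 * t + 0)); [intros; apply (f_equal exp); field|].
    apply is_lim_comp_lin with (f := exp); [|apply Rlt_not_eq; lra].
    replace (Rbar_plus _ _) with m_infty; [apply is_lim_exp_m|].
    simpl. destruct (Rle_dec 0 (- / 2)); [exfalso; lra|reflexivity]. }
  simpl in H. rewrite Rmult_0_r in H. exact H.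
Qed.

(** The primitive of f from 1 varies less than the primitive G of the
    majorant.  Since G has a limit at both ends, it is Cauchy there, hence so
    is the primitive of f. *)
Lemma ex_RInt_gen_dominated (f g G : R -> R) (la lb : R) :
  (forall t, 0 < t -> continuous f t) ->
  (forall t, 0 < t -> continuous g t) ->
  (forall t, 0 < t -> is_derive G t (g t)) ->
  (forall t, 0 < t -> Rabs (f t) <= g t) ->
  filterlim G (at_right 0) (locally la) ->
  filterlim G (Rbar_locally p_infty) (locally lb) ->
  exists l, is_RInt_gen f (at_right 0) (Rbar_locally p_infty) l.
Proof.
  intros Cf Cg DG Hfg Ha Hb.
  assert (Pf : forall a b, 0 < a -> 0 < b -> ex_RInt f a b).
  { intros a b H1 H2; apply (@ex_RInt_continuous R_CompleteNormedModule).
    intros z [Hz _]; apply Cf. revert Hz; apply Rmin_case; lra. }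
  assert (Pg : forall a b, 0 < a -> 0 < b -> is_RInt g a b (G b - G a)).
  { intros a b H1 H2. apply (@is_RInt_derive R_CompleteNormedModule G g).
    - intros z [Hz _]; apply DG. revert Hz; apply Rmin_case; lra.
    - intros z [Hz _]; apply Cg. revert Hz; apply Rmin_case; lra. }
  assert (Hle : forall a b, 0 < a -> a <= b -> Rabs (RInt f a b) <= G b - G a).
  { intros a b H1 H2.
    apply (norm_RInt_le f g a b).
    - exact H2.
    - intros t Ht; apply Hfg; lra.
    - apply (@RInt_correct R_CompleteNormedModule), Pf; lra.
    - apply Pg; lra. }
  assert (Hch : forall u v, 0 < u -> 0 < v -> RInt f 1 v - RInt f 1 u = RInt f u v).
  { intros u v Hu Hv.
    assert (E : RInt f 1 u + RInt f u v = RInt f 1 v)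
      by (apply (RInt_Chasles f 1 u v); apply Pf; lra).
    rewrite <- E; apply Rplus_minus_l. }
  assert (Hd : forall u v, 0 < u -> 0 < v ->
             Rabs (RInt f 1 v - RInt f 1 u) <= Rabs (G v - G u)).
  { assert (Hd : forall u v, 0 < u -> u <= v ->
             Rabs (RInt f 1 v - RInt f 1 u) <= Rabs (G v - G u)).
    { intros u v H1 H2.
      rewrite Hch by lra.
      eapply Rle_trans; [now apply Hle|apply Rle_abs]. }
    intros u v H1 H2; destruct (Rle_dec u v) as [H|H]; [now apply Hd|].
    rewrite (Rabs_minus_sym (RInt _ _ _)), (Rabs_minus_sym (G v)).
    apply Hd; lra. }
  assert (Hlim : forall (F : (R -> Prop) -> Prop) l, ProperFilter F -> F (fun t => 0 < t) ->
            filterlim G F (locally l) -> exists y, filterlim (fun b => RInt f 1 b) F (locally y)).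
  { intros F l PF Hpos HG.
    apply (@filterlim_locally_cauchy R R_CompleteSpace F PF).
    intros eps.
    destruct (proj2 (@filterlim_locally_cauchy R R_CompleteSpace F PF G)
                (ex_intro _ l HG) eps) as [P [HP1 HP2]].
    exists (fun t => P t /\ 0 < t); split; [now apply filter_and|].
    intros u v [Pu Hu] [Pv Hv].
    apply Rle_lt_trans with (2 := HP2 u v Pu Pv).
    now apply Hd. }
  assert (A0 : at_right 0 (fun t => 0 < t)).
  { exists (mkposreal 1 Rlt_0_1); intros y _ Hy; exact Hy. }
  assert (Ai : Rbar_locally p_infty (fun t => 0 < t)) by (exists 0; trivial).
  destruct (Hlim (at_right 0) la _ A0 Ha) as [ya Hya].
  destruct (Hlim (Rbar_locally p_infty) lb _ Ai Hb) as [yb Hyb].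
  exists (minus yb ya).
  apply (filterlimi_lim_ext_loc (fun ab => minus (RInt f 1 (snd ab)) (RInt f 1 (fst ab)))).
  - apply (Filter_prod _ _ _ (fun t => 0 < t) (fun t => 0 < t) A0 Ai).
    intros a b H1 H2; simpl.
    apply (is_RInt_ext f); [trivial|].
    replace (minus _ _) with (RInt f a b).
    + apply (@RInt_correct R_CompleteNormedModule); now apply Pf.
    + symmetry; now apply Hch.
  - apply (filterlim_comp_2 (F := filter_prod (at_right 0) (Rbar_locally p_infty)) (G := locally yb) (H := locally (opp ya)) (fun ab => RInt f 1 (snd ab)) (fun ab => opp (RInt f 1 (fst ab))) plus).
    + apply filterlim_comp with (2 := Hyb). apply filterlim_snd.
    + apply filterlim_comp with (G := locally ya) (g := opp).
      * apply filterlim_comp with (2 := Hya). apply filterlim_fst.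
      * apply (filterlim_opp ya).
    + apply (filterlim_plus yb (opp ya)).
Qed.

Lemma is_RInt_gen_Gamma s : 1 <= s ->
  is_RInt_gen (Gamma_integrand s) (at_right 0) (Rbar_locally p_infty) (Gamma s).
Proof.
  intros Hs; destruct (Gamma_integrand_le_exp s Hs) as [K [HK Hle]].
  destruct (ex_RInt_gen_dominated (Gamma_integrand s)
             (fun t => K * exp (- (t / 2))) (fun t => - (2 * K) * exp (- (t / 2)))
             (- (2 * K) * exp (- (0 / 2))) 0) as [l Hl].
  - intros t; apply continuous_Gamma_integrand.
  - intros t _; apply (ex_derive_continuous (fun t => K * exp (- (t / 2)))).
    auto_derive; trivial.
  - intros t _; auto_derive; [trivial|]. change (t * / 2) with (t / 2); field.
  - intros t Ht; rewrite Rabs_pos_eq by (left; apply Gamma_integrand_pos); now apply Hle.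
  - apply (ex_derive_filterlim_at_right (fun t => - (2 * K) * exp (- (t / 2)))).
    auto_derive; trivial. reflexivity.
  - exact (filterlim_scal_exp_half_infty K).
  - replace (Gamma s) with l; trivial.
    symmetry; apply (@is_RInt_gen_unique R_CompleteNormedModule (at_right 0) (Rbar_locally p_infty) _ _ (Gamma_integrand s)); exact Hl.
Qed.

(** The integrals over [a,b] with a < 1 and b > 2 all exceed the integral over
    [1,2], so their limit cannot be closer to 0 than that. *)
Lemma Gamma_pos s : 1 <= s -> 0 < Gamma s.
Proof.
  intros Hs.
  assert (Pf : forall a b, 0 < a -> 0 < b -> ex_RInt (Gamma_integrand s) a b).
  { intros a b H1 H2; apply (@ex_RInt_continuous R_CompleteNormedModule).
    intros z [Hz _]; apply continuous_Gamma_integrand. revert Hz; apply Rmin_case; lra. }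
  assert (Hm : 0 < RInt (Gamma_integrand s) 1 2).
  { apply RInt_gt_0; [lra| |].
    - intros; apply Gamma_integrand_pos.
    - intros; apply continuous_Gamma_integrand; lra. }
  set (m := RInt (Gamma_integrand s) 1 2) in *.
  destruct (proj1 (filterlimi_locally (F := filter_prod (at_right 0) (Rbar_locally p_infty))
    _ _) (is_RInt_gen_Gamma s Hs) (mkposreal m Hm)) as [P Q HP HQ HPQ].
  destruct (filter_ex (F := at_right 0) (fun a => P a /\ 0 < a < 1)) as [a [Pa Ha]].
  { apply filter_and; trivial. exists (mkposreal 1 Rlt_0_1); intros y Hy Hy0.
    change (Rabs (y - 0) < 1) in Hy; revert Hy; unfold Rabs; destruct Rcase_abs; lra. }
  destruct (filter_ex (F := Rbar_locally p_infty) (fun b => Q b /\ 2 < b)) as [b [Qb Hb]].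
  { apply filter_and; trivial. now exists 2. }
  destruct (HPQ a b Pa Qb) as [z [Hz Hball]]; simpl in Hz, Hball.
  change (Rabs (z - Gamma s) < m) in Hball.
  rewrite <- (is_RInt_unique _ _ _ _ Hz) in Hball.
  assert (m <= RInt (Gamma_integrand s) a b).
  { assert (E1 : RInt (Gamma_integrand s) a 1 + RInt (Gamma_integrand s) 1 b
                 = RInt (Gamma_integrand s) a b)
      by (apply (RInt_Chasles (Gamma_integrand s) a 1 b); apply Pf; lra).
    assert (E2 : m + RInt (Gamma_integrand s) 2 b = RInt (Gamma_integrand s) 1 b)
      by (apply (RInt_Chasles (Gamma_integrand s) 1 2 b); apply Pf; lra).
    assert (0 <= RInt (Gamma_integrand s) a 1).
    { apply RInt_ge_0; [lra|apply Pf; lra|]. intros; left; apply Gamma_integrand_pos. }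
    assert (0 <= RInt (Gamma_integrand s) 2 b).
    { apply RInt_ge_0; [lra|apply Pf; lra|]. intros; left; apply Gamma_integrand_pos. }
    lra. }
  revert Hball; unfold Rabs; destruct Rcase_abs; lra.
Qed.

(** Integration by parts: t^s exp(-t) vanishes at both ends, so its derivative
    s t^(s-1) exp(-t) - t^s exp(-t) has integral zero. *)
Lemma Gamma_succ s : 1 <= s -> Gamma (s + 1) = s * Gamma s.
Proof.
  intros Hs.
  set (h := Gamma_integrand (s + 1)).
  assert (Dh : forall t, 0 < t -> is_derive h t (s * Gamma_integrand s t - h t)).
  { intros t Ht; unfold h, Gamma_integrand at 1.
    replace (s * Gamma_integrand s t - Gamma_integrand (s + 1) t)
      with (plus (mult (s * Rpower t (s - 1)) (exp (- t)))
                 (mult (Rpower t (s + 1 - 1)) (- exp (- t)))).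
    - apply (is_derive_mult (fun t => Rpower t (s + 1 - 1)) (fun t => exp (- t))).
      + replace (s + 1 - 1) with s by ring. now apply is_derive_Rpower.
      + auto_derive; [trivial|ring].
      + intros; apply Rmult_comm.
    - unfold Gamma_integrand, plus, mult; simpl. ring. }
  assert (Hpos : filter_prod (at_right 0) (Rbar_locally p_infty)
     (fun ab : R * R => forall x, Rmin (fst ab) (snd ab) <= x <= Rmax (fst ab) (snd ab) -> 0 < x)).
  { apply (Filter_prod _ _ _ (fun t => 0 < t) (fun t => 0 < t)).
    - exists (mkposreal 1 Rlt_0_1); intros y _ Hy; exact Hy.
    - now exists 0.
    - intros a b Ha Hb x [Hx _]; simpl in Hx; revert Hx; apply Rmin_case; lra. }
  assert (Hd : is_RInt_gen (Derive h) (at_right 0) (Rbar_locally p_infty) (0 - 0)).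
  { apply (is_RInt_gen_Derive h 0 0).
    - apply filter_imp with (2 := Hpos); intros ab H x Hx.
      eexists; now apply Dh, H.
    - apply filter_imp with (2 := Hpos); intros ab H x Hx.
      apply continuous_ext_loc with (fun t => s * Gamma_integrand s t - h t).
      + exists (mkposreal x (H x Hx)); intros y Hy; symmetry; apply is_derive_unique, Dh.
        change (Rabs (y - x) < x) in Hy; revert Hy; unfold Rabs; destruct Rcase_abs; lra.
      + apply (continuous_minus (fun t => s * Gamma_integrand s t) h);
          [apply (continuous_scal_r s (Gamma_integrand s))|];
          apply continuous_Gamma_integrand; now apply H.
    - (* t^s exp(-t) = t * (t^(s-1) exp(-t)) with a bounded second factor *)
      destruct (Gamma_integrand_le_exp s Hs) as [K [HK Hle]].
      apply (filterlim_le_le (F := at_right 0) (fun _ => 0) h (fun t => K * t) 0).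
      + exists (mkposreal 1 Rlt_0_1); intros y _ Hy; split; [left; apply Gamma_integrand_pos|].
        replace (h y) with (y * Gamma_integrand s y).
        * specialize (Hle y Hy).
          assert (exp (- (y / 2)) <= 1) by (rewrite <- exp_0; apply exp_le_compat; lra).
          assert (Gamma_integrand s y <= K) by nra. nra.
        * unfold h, Gamma_integrand. replace (s + 1 - 1) with (1 + (s - 1)) by ring.
          rewrite Rpower_plus, Rpower_1 by trivial. ring.
      + apply filterlim_const.
      + apply (ex_derive_filterlim_at_right (fun t => K * t));
          [auto_derive; trivial|apply Rmult_0_r].
    - destruct (Gamma_integrand_le_exp (s + 1)) as [K [HK Hle]]; [lra|].
      apply (filterlim_le_le (F := Rbar_locally p_infty) (fun _ => 0) h (fun t => K * exp (- (t / 2))) 0).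
      + exists 0; intros y Hy; split; [left; apply Gamma_integrand_pos|now apply Hle].
      + apply filterlim_const.
      + apply filterlim_ext with (2 := filterlim_scal_exp_half_infty (- K / 2)).
        intros; field. }
  assert (Hs' := is_RInt_gen_minus _ _ _ _
     (is_RInt_gen_scal _ s _ (is_RInt_gen_Gamma s Hs))
     (is_RInt_gen_Gamma (s + 1) ltac:(lra))).
  assert (E : 0 - 0 = s * Gamma s - Gamma (s + 1)); [|lra].
  rewrite <- (is_RInt_gen_unique _ _ Hd).
  apply is_RInt_gen_unique.
  refine (is_RInt_gen_ext _ _ _ _ Hs').
  apply filter_imp with (2 := Hpos); intros ab H x Hx.
  symmetry; apply is_derive_unique, Dh, H; lra.
Qed.

Lemma Gamma_1 : Gamma 1 = 1.
Proof.
  assert (Hd : is_RInt_gen (Derive (fun t => - exp (- t))) (at_right 0) (Rbar_locally p_infty) (0 - -1)).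
  { assert (Dh : forall t, is_derive (fun t => - exp (- t)) t (exp (- t))).
    { intros; auto_derive; [trivial|ring]. }
    apply (is_RInt_gen_Derive (fun t => - exp (- t)) (-1) 0).
    - apply filter_forall; intros ab x _; eexists; apply Dh.
    - apply filter_forall; intros ab x _.
      apply continuous_ext with (fun t => exp (- t)).
      + intros; symmetry; apply is_derive_unique, Dh.
      + apply (ex_derive_continuous (fun t => exp (- t))); auto_derive; trivial.
    - apply (ex_derive_filterlim_at_right (fun t => - exp (- t))); [eexists; apply Dh|].
      now rewrite Ropp_0, exp_0.
    - assert (H : is_lim (fun t => - exp (- t)) p_infty (Rbar_opp 0)).
      { apply is_lim_opp.
        apply is_lim_ext with (fun t => exp (-1 * t + 0)); [intros; apply (f_equal exp); field|].
        apply is_lim_comp_lin with (f := exp); [|apply Rlt_not_eq; lra].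
        replace (Rbar_plus _ _) with m_infty; [apply is_lim_exp_m|].
        simpl. destruct (Rle_dec 0 (-1)); [exfalso; lra|reflexivity]. }
      simpl in H; rewrite Ropp_0 in H; exact H. }
  replace 1 with (0 - -1) at 2 by ring.
  apply (@is_RInt_gen_unique R_CompleteNormedModule (at_right 0) (Rbar_locally p_infty) _ _ (Gamma_integrand 1)).
  refine (is_RInt_gen_ext _ _ _ _ Hd).
  apply (Filter_prod _ _ _ (fun t => 0 < t) (fun t => 0 < t)).
    - exists (mkposreal 1 Rlt_0_1); intros y _ Hy; exact Hy.
    - now exists 0.
    - intros a b Ha Hb x [Hx _]; simpl in Hx.
      transitivity (exp (- x)).
      + apply is_derive_unique. auto_derive; [trivial|ring].
      + unfold Gamma_integrand; rewrite Rminus_diag, Rpower_O; [symmetry; apply Rmult_1_l|].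
        revert Hx; apply Rmin_case; lra.
Qed.

Lemma Gamma_nat n : Gamma (INR n + 1) = INR (fact n).
Proof.
  induction n as [|n IH].
  - simpl; rewrite Rplus_0_l; apply Gamma_1.
  - rewrite S_INR, Gamma_succ, IH, fact_simpl, mult_INR, S_INR; trivial.
    pose proof (pos_INR n); lra.
Qed.

(** * Complex series *)

Notation is_Cseries := (@is_series C_AbsRing C_NormedModule).

Lemma sum_n_C (u : nat -> C) n :
  @sum_n C_AbelianMonoid u n
  = (sum_n (fun k => Re (u k)) n, sum_n (fun k => Im (u k)) n).
Proof.
  induction n as [|n IH].
  - rewrite 3!sum_O; apply surjective_pairing.
  - rewrite 3!sum_Sn, IH; reflexivity.
Qed.

Lemma is_Cseries_iff (u : nat -> C) (l : C) :
  is_Cseries u l <->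
  is_series (fun n => Re (u n)) (Re l) /\ is_series (fun n => Im (u n)) (Im l).
Proof.
  assert (E : forall n, sum_n u n
     = (sum_n (fun k => Re (u k)) n, sum_n (fun k => Im (u k)) n)) by exact (sum_n_C u).
  split.
  - intros H; split; intros P [eps HP]; destruct (H (ball l eps)) as [N HN];
      try (now exists eps); exists N; intros n Hn; specialize (HN n Hn);
      apply HP; rewrite E in HN; apply HN.
  - intros [Hr Hi] P [eps HP].
    destruct (Hr (ball (Re l) eps)) as [N HN]; [now exists eps|].
    destruct (Hi (ball (Im l) eps)) as [M HM]; [now exists eps|].
    exists (Nat.max N M); intros n Hn; apply HP; rewrite E; split;
      [apply HN|apply HM]; lia.
Qed.

Lemma is_Cseries_unique u l : is_Cseries u l -> CSeries u = l.
Proof.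
  intros [Hr Hi]%is_Cseries_iff; unfold CSeries.
  rewrite (is_series_unique _ _ Hr), (is_series_unique _ _ Hi).
  symmetry; apply surjective_pairing.
Qed.

Lemma ex_series_Rabs_le (a b : nat -> R) :
  (forall n, Rabs (a n) <= b n) -> ex_series b -> ex_series (fun n => Rabs (a n)).
Proof.
  intros H; apply (@ex_series_le R_AbsRing R_CompleteNormedModule).
  intros n; change (Rabs (Rabs (a n)) <= b n); now rewrite Rabs_Rabsolu.
Qed.

Lemma is_series_sum_n {K : AbsRing} {V : NormedModule K}
    (a : nat -> nat -> V) (B : nat -> V) N :
  (forall n, is_series (a n) (B n)) ->
  is_series (fun m => sum_n (fun n => a n m) N) (sum_n B N).
Proof.
  intros H; induction N as [|N IH].
  - rewrite sum_O; apply is_series_ext with (2 := H 0%nat).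
    intros; now rewrite sum_O.
  - rewrite sum_Sn; apply is_series_ext with (2 := is_series_plus _ _ _ _ IH (H (S N))).
    intros; now rewrite sum_Sn.
Qed.

Lemma is_series_leading_zeros {K : AbsRing} {V : NormedModule K}
    (a : nat -> V) (l : V) m :
  (forall n, (n < m)%nat -> a n = zero) ->
  is_series (fun n => a (m + n)%nat) l -> is_series a l.
Proof.
  revert a; induction m as [|m IH]; intros a H0 Ha; [exact Ha|].
  assert (E : plus l (opp (a 0%nat)) = l) by (rewrite H0 by lia; exact (minus_zero_r l)).
  apply is_series_decr_1; rewrite E.
  apply IH; [|exact Ha]. intros n Hn; apply H0; lia.
Qed.

(** Exchange of summations when the general term is dominated by a product.
    Cutting the n-sum after N changes each column m by at most v m times the
    tail of u, uniformly in m; so it changes the sum of the columns by at most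
    that tail times the sum of v. *)
Lemma is_series_swap_dominated (a : nat -> nat -> R) (u v A B : nat -> R) :
  (forall n, 0 <= u n) -> (forall m, 0 <= v m) -> ex_series u -> ex_series v ->
  (forall n m, Rabs (a n m) <= u n * v m) ->
  (forall m, is_series (fun n => a n m) (A m)) ->
  (forall n, is_series (a n) (B n)) ->
  ex_series A /\ is_series B (Series A).
Proof.
  intros Hu Hv Eu Ev Hle HA HB.
  set (T N := Series (fun k => u (S N + k)%nat)).
  assert (ET : forall N, Series u = sum_n u N + T N).
  { intros N; unfold T; rewrite (Series_incr_n u (S N)), sum_n_Reals by (trivial; lia).
    reflexivity. }
  assert (Etail : forall N, ex_series (fun k => u (S N + k)%nat))
    by (intros; now apply (ex_series_incr_n u)).
  set (rm N m := Series (fun k => a (S N + k)%nat m)).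
  assert (EA : forall N m, A m = sum_n (fun n => a n m) N + rm N m).
  { intros N m; unfold rm. rewrite <- (is_series_unique _ _ (HA m)).
    rewrite (Series_incr_n _ (S N)), sum_n_Reals by (lia || now exists (A m)).
    reflexivity. }
  assert (Hrm : forall N m, Rabs (rm N m) <= T N * v m).
  { intros N m; unfold rm.
    assert (Ex : ex_series (fun k => Rabs (a (S N + k)%nat m))).
    { apply (ex_series_Rabs_le _ (fun k => u (S N + k)%nat * v m)).
      - intros k; apply Hle.
      - now apply ex_series_scal_r. }
    eapply Rle_trans; [now apply Series_Rabs|].
    unfold T; rewrite <- Series_scal_r; apply Series_le.
    - intros k; split; [apply Rabs_pos|apply Hle].
    - now apply ex_series_scal_r. }
  assert (HS : forall N, ex_series A /\
                 Rabs (Series A - sum_n B N) <= T N * Series v).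
  { intros N.
    assert (Ev' : ex_series (fun m => T N * v m)) by now apply (ex_series_scal_l (T N) v).
    assert (Er : ex_series (fun m => Rabs (rm N m))).
    { apply (ex_series_Rabs_le _ (fun m => T N * v m)); trivial. }
    assert (H : is_series A (sum_n B N + Series (rm N))).
    { apply is_series_ext with (fun m => sum_n (fun n => a n m) N + rm N m);
        [intros m; symmetry; apply EA|].
      apply (is_series_plus (fun m => sum_n (fun n => a n m) N) (rm N)).
      - exact (@is_series_sum_n R_AbsRing R_NormedModule a B N HB).
      - now apply Series_correct, ex_series_Rabs. }
    split; [eexists; exact H|].
    rewrite (is_series_unique _ _ H), Rplus_minus_l.
    eapply Rle_trans; [now apply Series_Rabs|].
    rewrite <- Series_scal_l; apply Series_le; trivial.
    intros m; split; [apply Rabs_pos|apply Hrm]. }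
  split; [apply (HS 0%nat)|].
  assert (HT : is_lim_seq T 0).
  { apply is_lim_seq_ext with (fun N => Series u - sum_n u N).
    - intros N; rewrite (ET N); ring.
    - replace (Finite 0) with (Finite (Series u - Series u)) by (f_equal; ring).
      apply is_lim_seq_minus'; [apply is_lim_seq_const|now apply Series_correct]. }
  change (is_lim_seq (sum_n B) (Series A)); apply (is_lim_seq_le_le (fun N => Series A - T N * Series v) _
           (fun N => Series A + T N * Series v)).
  - intros N; destruct (HS N) as [_ H]; revert H; unfold Rabs; destruct Rcase_abs; lra.
  - replace (Finite (Series A)) with (Finite (Series A - 0 * Series v)) by (f_equal; ring).
    apply is_lim_seq_minus'; [apply is_lim_seq_const|].
    apply is_lim_seq_mult'; [trivial|apply is_lim_seq_const].
  - replace (Finite (Series A)) with (Finite (Series A + 0 * Series v)) by (f_equal; ring).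
    apply is_lim_seq_plus'; [apply is_lim_seq_const|].
    apply is_lim_seq_mult'; [trivial|apply is_lim_seq_const].
Qed.

Lemma Re_le_Cmod z : Rabs (Re z) <= Cmod z.
Proof. eapply Rle_trans; [apply Rmax_l|apply Rmax_Cmod]. Qed.

Lemma Im_le_Cmod z : Rabs (Im z) <= Cmod z.
Proof. eapply Rle_trans; [apply Rmax_r|apply Rmax_Cmod]. Qed.

Lemma is_Cseries_swap_dominated (a : nat -> nat -> C) (u v : nat -> R) (A B : nat -> C) :
  (forall n, 0 <= u n) -> (forall m, 0 <= v m) -> ex_series u -> ex_series v ->
  (forall n m, Cmod (a n m) <= u n * v m) ->
  (forall m, is_Cseries (fun n => a n m) (A m)) ->
  (forall n, is_Cseries (a n) (B n)) ->
  is_Cseries B (CSeries A).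
Proof.
  intros Hu Hv Eu Ev Hle HA HB; apply is_Cseries_iff; split.
  - apply (is_series_swap_dominated (fun n m => Re (a n m)) u v); trivial.
    + intros n m; eapply Rle_trans; [apply Re_le_Cmod|apply Hle].
    + intros m; apply (is_Cseries_iff (fun n => a n m)), HA.
    + intros n; apply is_Cseries_iff, HB.
  - apply (is_series_swap_dominated (fun n m => Im (a n m)) u v); trivial.
    + intros n m; eapply Rle_trans; [apply Im_le_Cmod|apply Hle].
    + intros m; apply (is_Cseries_iff (fun n => a n m)), HA.
    + intros n; apply is_Cseries_iff, HB.
Qed.

(** * Principal powers with a real exponent *)

Lemma Cpower_RtoC_r z s :
  Cpower z (RtoC s)
  = (exp (s * ln (Cmod z)) * cos (s * Carg z), exp (s * ln (Cmod z)) * sin (s * Carg z)).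
Proof.
  unfold Cpower, Cexp, Clog, Cmult, RtoC, Re, Im; simpl.
  now rewrite !Rmult_0_l, Rminus_0_r, Rplus_0_r.
Qed.

Lemma Cexp_neq_0 w : Cexp w <> 0.
Proof.
  destruct w as [x y]; unfold Cexp, Re, Im; simpl fst; simpl snd; intros H; injection H; intros Hi Hr.
  pose proof (exp_pos x); pose proof (sin2_cos2 y) as H1; unfold Rsqr in H1.
  apply Rmult_integral in Hi; apply Rmult_integral in Hr.
  destruct Hi as [Hi|Hi]; [lra|]; destruct Hr as [Hr|Hr]; [lra|].
  rewrite Hi, Hr in H1; lra.
Qed.

Lemma Cpower_RtoC x s : 0 < x -> Cpower (RtoC x) (RtoC s) = RtoC (Rpower x s).
Proof.
  intros Hx; rewrite Cpower_RtoC_r, Cmod_R, Rabs_pos_eq by lra.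
  assert (Carg (RtoC x) = 0) as ->.
  { unfold Carg, RtoC, Re, Im; simpl.
    destruct (Rle_dec 0 0) as [_|H]; [|lra].
    change (x, 0) with (RtoC x); rewrite Cmod_R, Rabs_pos_eq by lra.
    replace (x / x) with 1 by (field; lra); apply acos_1. }
  now rewrite Rmult_0_r, cos_0, sin_0, Rmult_1_r, Rmult_0_r.
Qed.

(** Scaling by a positive real leaves the principal argument unchanged, so no
    branch correction appears. *)
Lemma Cpower_scal m w s : 0 < m -> w <> RtoC 0 ->
  Cpower (RtoC m * w) (RtoC s) = (RtoC (Rpower m s) * Cpower w (RtoC s))%C.
Proof.
  intros Hm Hw; rewrite !Cpower_RtoC_r.
  assert (Hw' : 0 < Cmod w) by now apply Cmod_gt_0.
  assert (Carg (RtoC m * w)%C = Carg w) as ->.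
  { unfold Carg; rewrite Cmod_mult, Cmod_R, Rabs_pos_eq by lra.
    replace (Re (RtoC m * w)%C) with (m * Re w) by (unfold Cmult, RtoC, Re; simpl; ring).
    replace (Im (RtoC m * w)%C) with (m * Im w) by (unfold Cmult, RtoC, Im; simpl; ring).
    replace (m * Re w / (m * Cmod w)) with (Re w / Cmod w) by (field; lra).
    destruct (Rle_dec 0 (Im w)) as [H|H], (Rle_dec 0 (m * Im w)) as [H'|H']; trivial;
      exfalso; nra. }
  rewrite Cmod_mult, Cmod_R, Rabs_pos_eq, ln_mult, Rmult_plus_distr_l, exp_plus by lra.
  unfold Rpower, Cmult, RtoC; simpl; f_equal; ring.
Qed.

(** On the right half-plane the argument is a smooth function, which the
    definition through [acos] and the sign of the imaginary part hides. *)
Lemma Carg_atan w : 0 < Re w -> Carg w = atan (Im w / Re w).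
Proof.
  destruct w as [a b]; unfold Carg, Cmod, Re, Im; simpl fst; simpl snd; intros Ha.
  assert (Hq : 0 < a ^ 2 + b ^ 2) by nra.
  set (q := a ^ 2 + b ^ 2) in *.
  assert (Hs : 0 < sqrt q) by now apply sqrt_lt_R0.
  assert (Hss : sqrt q * sqrt q = q) by (apply sqrt_sqrt; lra).
  assert (E : acos (a / sqrt q) = atan (Rabs b / a)).
  { rewrite acos_atan by now apply Rdiv_lt_0_compat.
    f_equal.
    replace (1 - (a / sqrt q)²) with ((Rabs b / sqrt q)²).
    - rewrite sqrt_Rsqr; [field; lra|].
      apply Rdiv_le_0_compat; [apply Rabs_pos|trivial].
    - unfold Rdiv; rewrite !Rsqr_mult, <- Rsqr_abs.
      assert (Hi : (/ sqrt q)² = / q) by (unfold Rsqr; rewrite <- Rinv_mult; now f_equal).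
      rewrite Hi; unfold Rsqr; apply Rmult_eq_reg_r with q; [|lra].
      field_simplify; [unfold q; ring|lra|lra]. }
  rewrite E; destruct (Rle_dec 0 b) as [H|H].
  - now rewrite Rabs_pos_eq.
  - rewrite Rabs_left, <- atan_opp by lra; f_equal; field; lra.
Qed.

Lemma Cpower_right_half_plane a b s : 0 < a ->
  Cpower (a, b) (RtoC s)
  = (exp (s / 2 * ln (a ^ 2 + b ^ 2)) * cos (s * atan (b / a)),
     exp (s / 2 * ln (a ^ 2 + b ^ 2)) * sin (s * atan (b / a))).
Proof.
  intros Ha; rewrite Cpower_RtoC_r, Carg_atan by trivial.
  unfold Re, Im, Cmod; simpl fst; simpl snd.
  replace (s * ln (sqrt (a ^ 2 + b ^ 2))) with (s / 2 * ln (a ^ 2 + b ^ 2)); trivial.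
  assert (Hq : 0 < a ^ 2 + b ^ 2) by nra.
  rewrite <- (sqrt_sqrt (a ^ 2 + b ^ 2)) at 1 by lra.
  rewrite ln_mult by now apply sqrt_lt_R0. field.
Qed.

(** * The binomial series *)

Lemma fact_INR_pos n : 0 < INR (fact n).
Proof. apply lt_0_INR, lt_O_fact. Qed.

Lemma gbinom_0 r : 0 <= r -> gbinom r 0 = 1.
Proof.
  intros Hr; unfold gbinom; simpl INR; rewrite Rplus_0_l.
  assert (H := Gamma_pos (r + 1) ltac:(lra)). simpl; field; lra.
Qed.

Lemma gbinom_pos r n : 0 <= r -> 0 < gbinom r n.
Proof.
  intros Hr; pose proof (pos_INR n); apply Rdiv_lt_0_compat; [apply Gamma_pos; lra|].
  apply Rmult_lt_0_compat; [apply Gamma_pos; lra|apply fact_INR_pos].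
Qed.

Lemma gbinom_S r n : 0 <= r ->
  INR (S n) * gbinom r (S n) = (INR n + (r + 1)) * gbinom r n.
Proof.
  intros Hr; unfold gbinom; pose proof (pos_INR n).
  rewrite fact_simpl, mult_INR, S_INR.
  replace (INR n + 1 + r + 1) with (INR n + r + 1 + 1) by ring.
  rewrite Gamma_succ by lra.
  assert (H1 := Gamma_pos (r + 1) ltac:(lra)); pose proof (fact_INR_pos n).
  field; lra.
Qed.

Lemma CV_radius_gbinom r : 0 <= r -> CV_radius (gbinom r) = 1.
Proof.
  intros Hr; rewrite (CV_radius_finite_DAlembert _ 1); [f_equal; apply Rinv_1| |lra|].
  - intros n; apply Rgt_not_eq; now apply gbinom_pos.
  - apply is_lim_seq_ext with (fun n => 1 + r * / INR (S n)).
    + intros n.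
      assert (H1 := gbinom_pos r n Hr); assert (H2 := gbinom_pos r (S n) Hr).
      assert (H3 := gbinom_S r n Hr).
      assert (Hn : 0 < INR (S n)) by (apply lt_0_INR; lia).
      rewrite Rabs_pos_eq by (apply Rdiv_le_0_compat; lra).
      apply Rmult_eq_reg_r with (INR (S n) * gbinom r n); [|nra].
      transitivity (INR (S n) * gbinom r (S n)); [|field; lra].
      rewrite H3, S_INR in *; field; lra.
    + replace (Finite 1) with (Finite (1 + r * 0)) by (f_equal; ring).
      apply is_lim_seq_plus'; [apply is_lim_seq_const|].
      apply is_lim_seq_mult'; [apply is_lim_seq_const|].
      apply (is_lim_seq_incr_1 (fun n => / INR n) 0).
      apply (is_lim_seq_inv _ p_infty); [apply is_lim_seq_INR|discriminate].
Qed.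

Lemma ex_series_gbinom r y : 0 <= r -> 0 <= y < 1 -> ex_series (fun n => gbinom r n * y ^ n).
Proof.
  intros Hr Hy.
  apply ex_series_ext with (fun n => Rabs (gbinom r n * y ^ n)).
  - intros n; apply Rabs_pos_eq, Rmult_le_pos; [left; now apply gbinom_pos|now apply pow_le].
  - apply CV_disk_inside; rewrite CV_radius_gbinom by trivial.
    rewrite Rabs_pos_eq; simpl; lra.
Qed.


Lemma gbinom_pow_S r z n : 0 <= r ->
  (RtoC (INR (S n)) * (RtoC (gbinom r (S n)) * z ^ S n))%C
  = (RtoC (INR n + (r + 1)) * (z * (RtoC (gbinom r n) * z ^ n)))%C.
Proof.
  intros Hr; rewrite Cpow_S.
  transitivity (RtoC (INR (S n) * gbinom r (S n)) * (z * z ^ n))%C;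
    [|rewrite gbinom_S by trivial]; rewrite RtoC_mult; ring.
Qed.

(** The sequence b stands for the real or imaginary part of the coefficients
    of t |-> sum_n (n+r choose n) (tz)^n.  The radius is at least
    2 / (1 + |z|), which exceeds 1, so that t = 1 is an interior point. *)
Lemma CV_radius_gbinom_pow r z (b : nat -> R) t :
  0 <= r -> Cmod z < 1 ->
  (forall n, Rabs (b n) <= Cmod (RtoC (gbinom r n) * z ^ n)%C) ->
  0 <= t <= 1 -> Rbar_lt (Rabs t) (CV_radius b).
Proof.
  intros Hr Hz Hb Ht; rewrite Rabs_pos_eq by lra.
  pose proof (Cmod_ge_0 z).
  set (T := 2 / (1 + Cmod z)).
  assert (HT : T * (1 + Cmod z) = 2) by (unfold T; field; lra).
  assert (HT1 : 1 < T) by nra.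
  assert (HT2 : 0 <= Cmod z * T < 1) by (split; nra).
  apply Rbar_lt_le_trans with (Finite T); [simpl; lra|].
  apply (proj1 (Lub_Rbar_correct (CV_disk b))).
  apply (ex_series_Rabs_le _ (fun n => gbinom r n * (Cmod z * T) ^ n)).
  - intros n; rewrite Rabs_mult, Rpow_mult_distr, <- Rmult_assoc.
    rewrite (Rabs_pos_eq (T ^ n)) by (apply pow_le; lra).
    apply Rmult_le_compat_r; [apply pow_le; lra|].
    eapply Rle_trans; [apply Hb|].
    rewrite Cmod_mult, Cmod_R, Cmod_pow, Rabs_pos_eq; [apply Rle_refl|].
    left; now apply gbinom_pos.
  - now apply ex_series_gbinom.
Qed.

(** The recurrence on coefficients translates to A' = x (t B' + s B) +
    y (t C' + s C), because n b_n are the coefficients of t B'.  It is stated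
    with two series on the right to serve for both real and imaginary parts. *)
Lemma PSeries_derive_recurrence (a b c : nat -> R) s x y t :
  (forall n, INR (S n) * a (S n) = (INR n + s) * (x * b n + y * c n)) ->
  Rbar_lt (Rabs t) (CV_radius b) -> Rbar_lt (Rabs t) (CV_radius c) ->
  PSeries (PS_derive a) t
  = x * (t * PSeries (PS_derive b) t + s * PSeries b t)
    + y * (t * PSeries (PS_derive c) t + s * PSeries c t).
Proof.
  intros Ha Hb Hc.
  assert (H : forall e, Rbar_lt (Rabs t) (CV_radius e) ->
     is_pseries (fun n => (INR n + s) * e n) t (t * PSeries (PS_derive e) t + s * PSeries e t)).
  { intros e He.
    assert (H1 : is_pseries (PS_derive e) t (PSeries (PS_derive e) t))
      by (apply PSeries_correct, CV_radius_inside; now rewrite CV_radius_derive).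
    apply is_pseries_incr_1 in H1.
    assert (H2 := is_pseries_scal s _ t _ (Rmult_comm _ _) (PSeries_correct _ _ (CV_radius_inside _ _ He))).
    refine (is_pseries_ext _ _ _ _ _ (is_pseries_plus _ _ _ _ _ H1 H2)).
    intros [|n]; unfold PS_plus, PS_scal, PS_incr_1, PS_derive.
    - change (0 + s * e 0%nat = (INR 0 + s) * e 0%nat); simpl; ring.
    - change (INR (S n) * e (S n) + s * e (S n) = (INR (S n) + s) * e (S n)); ring. }
  assert (H1 := is_pseries_scal x _ t _ (Rmult_comm _ _) (H b Hb)).
  assert (H2 := is_pseries_scal y _ t _ (Rmult_comm _ _) (H c Hc)).
  apply is_pseries_unique.
  refine (is_pseries_ext _ _ _ _ _ (is_pseries_plus _ _ _ _ _ H1 H2)).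
  intros n; unfold PS_plus, PS_scal, PS_derive; rewrite Ha.
  change (x * ((INR n + s) * b n) + y * ((INR n + s) * c n)
          = (INR n + s) * (x * b n + y * c n)); ring.
Qed.

(** With z = u + iv, the two derivatives are the components of
    -z / (1 - tz), the derivative of log(1 - tz); the first is doubled since it
    bears on the squared modulus. *)
Lemma is_derive_Clog_segment (u v t : R) :
  0 < 1 - t * u ->
  is_derive (fun t => ln ((1 - t * u) ^ 2 + (- (t * v)) ^ 2)) t
    (- 2 * ((u * (1 - t * u) - t * v ^ 2) / ((1 - t * u) ^ 2 + (- (t * v)) ^ 2)))
  /\ is_derive (fun t => atan (- (t * v) / (1 - t * u))) t
    (- (v / ((1 - t * u) ^ 2 + (- (t * v)) ^ 2))).
Proof.
  intros Ha; set (a := 1 - t * u) in *.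
  assert (Hq : 0 < a ^ 2 + (- (t * v)) ^ 2) by nra.
  split; auto_derive.
  - exact Hq.
  - replace (1 + - (t * u)) with a by (unfold a; ring). field. lra.
  - apply Rgt_not_eq; exact Ha.
  - replace (1 + - (t * u)) with a by (unfold a; ring).
    replace (- (1 * v)) with (- v) by ring.
    transitivity (- v * (a + t * u) / (a ^ 2 + (- (t * v)) ^ 2)).
    + field; split; apply Rgt_not_eq; trivial.
    + unfold a at 1; field; lra.
Qed.

Lemma is_derive_exp_cos_sin (f g : R -> R) (t df dg : R) :
  is_derive f t df -> is_derive g t dg ->
  is_derive (fun t => exp (f t) * cos (g t)) t
    (df * (exp (f t) * cos (g t)) - dg * (exp (f t) * sin (g t)))
  /\ is_derive (fun t => exp (f t) * sin (g t)) t
    (df * (exp (f t) * sin (g t)) + dg * (exp (f t) * cos (g t))).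
Proof.
  intros Hf Hg; split; auto_derive.
  - repeat split; eexists; eassumption.
  - change (fun x => f x) with f; change (fun x => g x) with g.
    rewrite (is_derive_unique _ _ _ Hf), (is_derive_unique _ _ _ Hg); ring.
  - repeat split; eexists; eassumption.
  - change (fun x => f x) with f; change (fun x => g x) with g.
    rewrite (is_derive_unique _ _ _ Hf), (is_derive_unique _ _ _ Hg); ring.
Qed.

(** If B' = wB and E' = -wE for complex functions B, E and w of a real
    variable, then BE has derivative zero. *)
Lemma product_inverse_logarithmic_derivatives (br bi er ei : R -> R) (wr wi : R -> R) :
  (forall t, 0 <= t <= 1 ->
     is_derive br t (wr t * br t - wi t * bi t) /\
     is_derive bi t (wr t * bi t + wi t * br t) /\
     is_derive er t (- (wr t * er t - wi t * ei t)) /\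
     is_derive ei t (- (wr t * ei t + wi t * er t))) ->
  ((br 1, bi 1) * (er 1, ei 1))%C = ((br 0, bi 0) * (er 0, ei 0))%C.
Proof.
  intros H; unfold Cmult; simpl fst; simpl snd.
  f_equal; symmetry.
  - apply (eq_is_derive (fun t => br t * er t - bi t * ei t) 0 1); [|lra].
    intros t Ht; destruct (H t Ht) as [H1 [H2 [H3 H4]]]; auto_derive.
    + repeat split; eexists; eassumption.
    + change (fun x => br x) with br; change (fun x => bi x) with bi.
      change (fun x => er x) with er; change (fun x => ei x) with ei.
      rewrite (is_derive_unique _ _ _ H1), (is_derive_unique _ _ _ H2),
        (is_derive_unique _ _ _ H3), (is_derive_unique _ _ _ H4).
      change (@zero R_NormedModule) with 0; ring.
  - apply (eq_is_derive (fun t => br t * ei t + bi t * er t) 0 1); [|lra].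
    intros t Ht; destruct (H t Ht) as [H1 [H2 [H3 H4]]]; auto_derive.
    + repeat split; eexists; eassumption.
    + change (fun x => br x) with br; change (fun x => bi x) with bi.
      change (fun x => er x) with er; change (fun x => ei x) with ei.
      rewrite (is_derive_unique _ _ _ H1), (is_derive_unique _ _ _ H2),
        (is_derive_unique _ _ _ H3), (is_derive_unique _ _ _ H4).
      change (@zero R_NormedModule) with 0; ring.
Qed.

(** Let B(t) be the series at tz and E(t) = (1 - tz)^(r+1).  The recurrence
    (n+1) b_(n+1) = (n+r+1) z b_n gives (1 - tz) B' = (r+1) z B, while
    (1 - tz) E' = -(r+1) z E.  Hence BE is constant on [0,1] and equal to its
    value 1 at t = 0. *)
Lemma binomial_series (r : R) (z : C) : 0 <= r -> Cmod z < 1 ->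
  is_Cseries (fun n => RtoC (gbinom r n) * z ^ n)%C (/ Cpower (1 - z) (RtoC (r + 1)))%C.
Proof.
  intros Hr Hz.
  set (s := r + 1); set (u := Re z); set (v := Im z).
  set (br n := Re (RtoC (gbinom r n) * z ^ n)%C).
  set (bi n := Im (RtoC (gbinom r n) * z ^ n)%C).
  assert (br_S : forall n, INR (S n) * br (S n) = (INR n + s) * (u * br n + - v * bi n)).
  { intros n; assert (H := f_equal Re (gbinom_pow_S r z n Hr)).
    rewrite (re_scal_l (INR (S n))), (re_scal_l (INR n + (r + 1))) in H.
    unfold br, bi, u, v, s; rewrite H.
    destruct (RtoC (gbinom r n) * z ^ n)%C as [a b], z as [x y]; unfold Re, Im, Cmult; simpl; ring. }
  assert (bi_S : forall n, INR (S n) * bi (S n) = (INR n + s) * (u * bi n + v * br n)).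
  { intros n; assert (H := f_equal Im (gbinom_pow_S r z n Hr)).
    rewrite (im_scal_l (INR (S n))), (im_scal_l (INR n + (r + 1))) in H.
    unfold br, bi, u, v, s; rewrite H.
    destruct (RtoC (gbinom r n) * z ^ n)%C as [a b], z as [x y]; unfold Re, Im, Cmult; simpl; ring. }
  assert (Rr : forall t, 0 <= t <= 1 -> Rbar_lt (Rabs t) (CV_radius br))
    by (intros t; apply (CV_radius_gbinom_pow r z); trivial; intros n; apply Re_le_Cmod).
  assert (Ri : forall t, 0 <= t <= 1 -> Rbar_lt (Rabs t) (CV_radius bi))
    by (intros t; apply (CV_radius_gbinom_pow r z); trivial; intros n; apply Im_le_Cmod).
  assert (Hright : forall t, 0 <= t <= 1 -> 0 < 1 - t * u).
  { intros t Ht.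
    assert (u < 1).
    { apply Rle_lt_trans with (Rabs u); [apply Rle_abs|].
      apply Rle_lt_trans with (2 := Hz); apply Re_le_Cmod. }
    destruct (Rle_dec u 0); nra. }
  set (q t := (1 - t * u) ^ 2 + (- (t * v)) ^ 2).
  set (er t := exp (s / 2 * ln (q t)) * cos (s * atan (- (t * v) / (1 - t * u)))).
  set (ei t := exp (s / 2 * ln (q t)) * sin (s * atan (- (t * v) / (1 - t * u)))).
  assert (Hp := product_inverse_logarithmic_derivatives (PSeries br) (PSeries bi) er ei
     (fun t => s * ((u * (1 - t * u) - t * v ^ 2) / q t)) (fun t => s * (v / q t))).
  assert (HE : (1 - z)%C = (1 - 1 * u, - (1 * v))).
  { unfold u, v; destruct z as [x y]; unfold Re, Im, Cminus, Cplus, Copp, RtoC; simpl; f_equal; ring. }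
  assert (HE1 : Cpower (1 - z) (RtoC s) = (er 1, ei 1)).
  { rewrite HE; apply Cpower_right_half_plane, Hright; lra. }
  assert (HE0 : (er 0, ei 0) = RtoC 1).
  { unfold er, ei, q; rewrite !Rmult_0_l, Ropp_0, Rdiv_0_l, atan_0, Rmult_0_r, cos_0, sin_0.
    replace ((1 - 0) ^ 2 + 0 ^ 2) with 1 by ring. rewrite ln_1, Rmult_0_r, exp_0.
    unfold RtoC; f_equal; ring. }
  assert (HB0 : (PSeries br 0, PSeries bi 0) = RtoC 1).
  { rewrite !PSeries_0; unfold br, bi; rewrite gbinom_0 by trivial.
    unfold Re, Im, Cmult, RtoC; simpl; f_equal; ring. }
  rewrite HE0, HB0, <- HE1 in Hp.
  assert (HB1 : (PSeries br 1, PSeries bi 1) = (/ Cpower (1 - z) (RtoC s))%C).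
  { assert (Hn := Cexp_neq_0 (RtoC s * Clog (1 - z))); fold (Cpower (1 - z) (RtoC s)) in Hn.
    transitivity ((PSeries br 1, PSeries bi 1) * Cpower (1 - z) s * / Cpower (1 - z) s)%C;
      [rewrite <- Cmult_assoc, Cinv_r, Cmult_1_r by exact Hn; reflexivity|].
    rewrite Hp; [now rewrite !Cmult_1_l|].
    intros t Ht; specialize (Hright t Ht).
    assert (Hq : 0 < q t) by (unfold q; nra).
    destruct (is_derive_Clog_segment u v t Hright) as [D1 D2]; fold (q t) in D1, D2.
    apply (is_derive_scal _ _ (s / 2)) in D1; apply (is_derive_scal _ _ s) in D2.
    destruct (is_derive_exp_cos_sin _ _ _ _ _ D1 D2) as [D3 D4].
    assert (E1 := PSeries_derive_recurrence _ _ _ _ _ _ t br_S (Rr t Ht) (Ri t Ht)).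
    assert (E2 := PSeries_derive_recurrence _ _ _ _ _ _ t bi_S (Ri t Ht) (Rr t Ht)).
    set (dr := PSeries (PS_derive br) t) in *; set (di := PSeries (PS_derive bi) t) in *.
    set (Br := PSeries br t) in *; set (Bi := PSeries bi t) in *.
    (* Real and imaginary parts of (1 - tz) B' = s z B; multiplying by the
       conjugate of 1 - tz, of squared modulus q t, solves them for B'. *)
    assert (E3 : dr * (1 - t * u) + di * (t * v) = s * (u * Br - v * Bi)) by lra.
    assert (E4 : di * (1 - t * u) - dr * (t * v) = s * (u * Bi + v * Br)) by lra.
    assert (E5 : dr * q t = (dr * (1 - t * u) + di * (t * v)) * (1 - t * u)
                            - (di * (1 - t * u) - dr * (t * v)) * (t * v)) by (unfold q; ring).
    assert (E6 : di * q t = (dr * (1 - t * u) + di * (t * v)) * (t * v)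
                            + (di * (1 - t * u) - dr * (t * v)) * (1 - t * u)) by (unfold q; ring).
    rewrite E3, E4 in E5, E6.
    split; [|split; [|split]].
    - replace (_ - _) with dr; [now apply is_derive_PSeries, Rr|].
      apply Rmult_eq_reg_r with (q t); [|lra]. rewrite E5; field; lra.
    - replace (_ + _) with di; [now apply is_derive_PSeries, Ri|].
      apply Rmult_eq_reg_r with (q t); [|lra]. rewrite E6; field; lra.
    - replace (- _) with (s / 2 * (-2 * ((u * (1 - t * u) - t * v ^ 2) / q t)) * er t
          - s * - (v / q t) * ei t) by (field; lra). exact D3.
    - replace (- _) with (s / 2 * (-2 * ((u * (1 - t * u) - t * v ^ 2) / q t)) * ei t
          + s * - (v / q t) * er t) by (field; lra). exact D4. }
  rewrite <- HB1; apply is_Cseries_iff; split.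
  - apply is_series_ext with (fun n => br n * 1 ^ n); [intros; rewrite pow1; apply Rmult_1_r|].
    apply (proj1 (is_pseries_R br 1 _)), PSeries_correct, CV_radius_inside, Rr; lra.
  - apply is_series_ext with (fun n => bi n * 1 ^ n); [intros; rewrite pow1; apply Rmult_1_r|].
    apply (proj1 (is_pseries_R bi 1 _)), PSeries_correct, CV_radius_inside, Ri; lra.
Qed.

(** * Zeta values as Dirichlet series *)

(** Mean value theorem for t^-s between x and x + 1. *)
Lemma Rpower_telescope x s : 0 < x -> 0 < s ->
  Rpower (x + 1) (- (s + 1)) <= / s * (Rpower x (- s) - Rpower (x + 1) (- s)).
Proof.
  intros Hx Hs.
  destruct (MVT_gen (fun t => Rpower t (- s)) x (x + 1) (fun t => - s * Rpower t (- s - 1)))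
    as [c [Hc E]].
  - rewrite Rmin_left by lra; intros t Ht; apply is_derive_Rpower; lra.
  - rewrite Rmin_left by lra; intros t Ht; apply derivable_continuous_pt.
    eexists; apply derivable_pt_lim_power; lra.
  - rewrite Rmin_left, Rmax_right in Hc by lra.
    replace (/ s * _) with (Rpower c (- (s + 1))).
    + rewrite !Rpower_Ropp; apply Rinv_le_contravar; [apply exp_pos|].
      apply Rle_Rpower_l; lra.
    + apply Rmult_eq_reg_l with s; [|lra].
      replace (- (s + 1)) with (- s - 1) by ring. field_simplify; lra.
Qed.

Lemma ex_series_Rpower s : 0 < s -> ex_series (fun k => Rpower (INR k + 2) (- (s + 1))).
Proof.
  intros Hs.
  destruct (ex_finite_lim_seq_incr (sum_n (fun k => Rpower (INR k + 2) (- (s + 1)))) (/ s))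
    as [l Hl].
  - intros n; rewrite sum_Sn; unfold plus; simpl.
    assert (H := exp_pos (- (s + 1) * ln (INR (S n) + 2))); unfold Rpower. simpl in *. lra.
  - intros n.
    apply Rle_trans with (/ s * (1 - Rpower (INR n + 2) (- s))).
    + induction n as [|n IH].
      * rewrite sum_O; assert (H := Rpower_telescope 1 s ltac:(lra) Hs).
        assert (H1 : Rpower 1 (- s) = 1) by (unfold Rpower; now rewrite ln_1, Rmult_0_r, exp_0).
        rewrite H1 in H.
        simpl INR; replace (0 + 2) with (1 + 1) by ring; exact H.
      * rewrite sum_Sn; pose proof (pos_INR n).
        assert (H1 := Rpower_telescope (INR n + 2) s ltac:(lra) Hs).
        rewrite S_INR; replace (INR n + 1 + 2) with (INR n + 2 + 1) by ring.
        unfold plus; simpl; lra.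
    + assert (0 < Rpower (INR n + 2) (- s)) by apply exp_pos.
      assert (0 < / s) by now apply Rinv_0_lt_compat. nra.
  - now exists l.
Qed.

Lemma is_Cseries_RtoC (u : nat -> R) l :
  is_series u l -> is_Cseries (fun n => RtoC (u n)) (RtoC l).
Proof.
  intros H; apply is_Cseries_iff; split; [exact H|].
  apply (is_series_ext (fun n => 0 * u n)); [intros; apply Rmult_0_l|].
  replace (Im l) with (0 * l) by apply Rmult_0_l.
  apply (is_series_scal 0 u l H).
Qed.

Lemma is_Cseries_zeta_minus_1 s : 1 < s ->
  is_Cseries (fun k => RtoC (Rpower (INR k + 2) (- s))) (zeta (RtoC s) - 1)%C.
Proof.
  intros Hs.
  destruct (ex_series_Rpower (s - 1)) as [l Hl]; [lra|].
  replace (s - 1 + 1) with s in Hl by ring.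
  assert (H : is_series (fun k => Rpower (INR k + 1) (- s)) (1 + l)).
  { apply is_series_decr_1.
    replace (plus (1 + l) _) with l.
    - apply is_series_ext with (2 := Hl); intros k; rewrite S_INR; f_equal; ring.
    - simpl; unfold Rpower; rewrite Rplus_0_l, ln_1, Rmult_0_r, exp_0.
      symmetry; exact (Rplus_minus_l 1 l). }
  assert (E : zeta (RtoC s) = RtoC (1 + l)).
  { apply is_Cseries_unique.
    refine (is_series_ext _ _ _ _ (is_Cseries_RtoC _ _ H)).
    intros k; pose proof (pos_INR k).
    rewrite <- RtoC_plus, Cpower_RtoC, Rpower_Ropp, RtoC_inv; trivial; [|lra].
    apply Rgt_not_eq, exp_pos. }
  rewrite E; replace (RtoC (1 + l) - 1)%C with (RtoC l); [now apply is_Cseries_RtoC|].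
  rewrite RtoC_plus; ring.
Qed.

Lemma Cseries_scal (c : C) (u : nat -> C) (l : C) :
  is_Cseries u l -> is_Cseries (fun n => c * u n)%C (c * l)%C.
Proof. exact (is_series_scal (K := C_AbsRing) (V := C_NormedModule) c u l). Qed.

(** Factoring m out of m - x.  The base 1 - x/m cannot vanish, as
    |x| < 2 <= m. *)
Lemma Cpower_shift (x : C) (m s : R) : 2 <= m -> Cmod x < 2 ->
  (/ Cpower (RtoC m - x) (RtoC s))%C
  = (RtoC (Rpower m (- s)) * / Cpower (1 - x * RtoC (/ m)) (RtoC s))%C.
Proof.
  intros Hm Hx.
  assert (Hm0 : RtoC m <> 0) by (intros H; injection H; lra).
  assert (Hw : (1 - x * RtoC (/ m))%C <> RtoC 0).
  { intros H.
    assert (E : x = RtoC m).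
    { rewrite RtoC_inv in H by lra.
      replace x with (RtoC m - RtoC m * (1 - x * / RtoC m))%C by (field; exact Hm0).
      rewrite H; ring. }
    rewrite E, Cmod_R, Rabs_pos_eq in Hx; lra. }
  replace (RtoC m - x)%C with (RtoC m * (1 - x * RtoC (/ m)))%C
    by (rewrite RtoC_inv by lra; field; exact Hm0).
  rewrite Cpower_scal, Rpower_Ropp, (RtoC_inv (Rpower m s)) by
    (trivial; try lra; apply Rgt_not_eq, exp_pos).
  field; split; [apply Cexp_neq_0|].
  intros H; injection H; apply Rgt_not_eq, exp_pos.
Qed.

(** The case p = 0 of the theorem: the double series of
    (n+r choose n) x^n m^-(n+r+1), with m = k + 2, summed both ways. *)
Lemma hurwitz_zeta_expansion r x : 0 < r -> Cmod x < 2 ->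
  is_Cseries (fun n => RtoC (gbinom r n) * (zeta (RtoC (INR n + r + 1)) - 1) * x ^ n)%C
    (hurwitz_zeta (RtoC (r + 1)) (RtoC 2 - x)).
Proof.
  intros Hr Hx; pose proof (Cmod_ge_0 x).
  set (a n m := (RtoC (gbinom r n) * x ^ n * RtoC (Rpower (INR m + 2) (- (INR n + r + 1))))%C).
  assert (Ha : forall n m, a n m = (RtoC (Rpower (INR m + 2) (- (r + 1)))
       * (RtoC (gbinom r n) * (x * RtoC (/ (INR m + 2))) ^ n))%C).
  { intros n m; unfold a; pose proof (pos_INR m).
    replace (- (INR n + r + 1)) with (- (r + 1) + - INR n) by ring.
    rewrite Rpower_plus, (Rpower_Ropp _ (INR n)), Rpower_pow, Cpow_mult_l, <- RtoC_pow, <- pow_inv by lra.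
    rewrite RtoC_mult; ring. }
  unfold hurwitz_zeta.
  apply (is_Cseries_swap_dominated a (fun n => gbinom r n * (Cmod x / 2) ^ n)
           (fun m => Rpower (INR m + 2) (- (r + 1)))).
  - intros n; apply Rmult_le_pos; [left; apply gbinom_pos; lra|apply pow_le; lra].
  - intros m; left; apply exp_pos.
  - apply ex_series_gbinom; lra.
  - now apply ex_series_Rpower.
  - intros n m; pose proof (pos_INR m); pose proof (gbinom_pos r n ltac:(lra)).
    assert (0 < Rpower (INR m + 2) (- (r + 1))) by apply exp_pos.
    assert (0 < / (INR m + 2) <= / 2).
    { split; [apply Rinv_0_lt_compat; lra|apply Rinv_le_contravar; lra]. }
    rewrite Ha, !Cmod_mult, Cmod_pow, Cmod_mult, !Cmod_R, !Rabs_pos_eq by lra.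
    rewrite Rmult_comm; apply Rmult_le_compat_r; [lra|].
    apply Rmult_le_compat_l; [lra|].
    apply pow_incr; split; [apply Rmult_le_pos; lra|].
    unfold Rdiv; apply Rmult_le_compat_l; lra.
  - intros m; pose proof (pos_INR m).
    replace (RtoC (INR m) + (2 - x))%C with (RtoC (INR m + 2) - x)%C
      by (rewrite RtoC_plus; ring).
    rewrite Cpower_shift by (trivial; lra).
    apply (is_series_ext (V := C_NormedModule) _ _ _ (fun n => eq_sym (Ha n m))).
    apply Cseries_scal, binomial_series; [lra|].
    rewrite Cmod_mult, Cmod_R, Rabs_pos_eq by (left; apply Rinv_0_lt_compat; lra).
    apply Rmult_lt_reg_r with (INR m + 2); [lra|].
    rewrite Rmult_assoc, Rinv_l by lra. lra.
  - intros n; pose proof (pos_INR n).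
    replace (RtoC (gbinom r n) * (zeta (RtoC (INR n + r + 1)) - 1) * x ^ n)%C
      with (RtoC (gbinom r n) * x ^ n * (zeta (RtoC (INR n + r + 1)) - 1))%C by ring.
    apply Cseries_scal, is_Cseries_zeta_minus_1; lra.
Qed.

(** * Stirling numbers and falling factorials *)

Fixpoint falling (x : R) (j : nat) : R :=
  match j with
  | O => 1
  | S j' => falling x j' * (x - INR j')
  end.

Lemma falling_INR_lt n j : (n < j)%nat -> falling (INR n) j = 0.
Proof.
  induction j as [|j IH]; intros H; [lia|]; simpl.
  destruct (Nat.eq_dec n j) as [->|]; [ring|].
  rewrite IH by lia; ring.
Qed.

Lemma falling_INR_fact j n : falling (INR (j + n)) j * INR (fact n) = INR (fact (j + n)).
Proof.
  revert n; induction j as [|j IH]; intros n; [simpl; ring|].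
  cbn [falling]; replace (S j + n)%nat with (j + S n)%nat by lia.
  rewrite <- IH, fact_simpl, mult_INR, plus_INR; ring.
Qed.

Lemma stirling2_lt p j : (p < j)%nat -> stirling2 p j = 0%nat.
Proof.
  revert j; induction p as [|p IH]; intros [|j] H; try lia; [reflexivity|].
  cbn [stirling2]; rewrite !IH by lia; lia.
Qed.

Lemma sum_Sn_R (u : nat -> R) n : sum_n u (S n) = sum_n u n + u (S n) :> R.
Proof. exact (sum_Sn (G := R_AbelianMonoid) u n). Qed.

(** Since x falling(x,j) = falling(x,j+1) + j falling(x,j), multiplying by x
    raises p by one; the last term is the boundary contribution of the
    truncation at N, and disappears once N > p. *)
Lemma sum_stirling2_falling_S p x N :
  sum_n (fun j => INR (stirling2 (S p) j) * falling x j) N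
  = x * sum_n (fun j => INR (stirling2 p j) * falling x j) N
    - INR (stirling2 p N) * falling x (S N) :> R.
Proof.
  induction N as [|N IH].
  - rewrite !sum_O; simpl; ring.
  - rewrite !sum_Sn_R, IH; cbn [stirling2 falling].
    rewrite plus_INR, mult_INR; ring.
Qed.

Lemma pow_stirling2 p x :
  x ^ p = sum_n (fun j => INR (stirling2 p j) * falling x j) p :> R.
Proof.
  induction p as [|p IH].
  - rewrite sum_O; simpl; ring.
  - rewrite sum_stirling2_falling_S, sum_Sn_R, <- IH, stirling2_lt by lia.
    simpl; ring.
Qed.

(** * The moment series *)

(** The only j below the first index is j = 0 with p >= 1, where S(p,0) = 0. *)
Lemma stirling2_first_index p j :
  stirling2 p j = 0%nat \/ (first_index p <= j)%nat.
Proof. destruct p, j; simpl; auto; right; lia. Qed.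

(* [ring] recognizes the field of complex numbers only through its own
   carrier and operations, not through those of the normed module. *)
Ltac C_ring :=
  change (@zero C_NormedModule) with (RtoC 0);
  change (@plus C_AbelianMonoid) with Cplus;
  change (@mult C_Ring) with Cmult;
  match goal with |- @eq _ ?a ?b => change (@eq C a b) end; ring.

(** The falling factorial kills the terms with n < j; the substitution
    n := j + n then yields the expansion of zeta(r+j+1, 2-x).  Any starting
    index n0 <= j gives the same sum, but n0 = 0 is excluded for r = 0 in the
    application, as zeta(1) is meaningless. *)
Lemma falling_moment_series r x j n0 : 0 < r + INR j -> 0 <= r -> Cmod x < 2 ->
  (n0 <= j)%nat ->
  is_Cseries (fun n =>
      RtoC (gbinom r (n0 + n)) * RtoC (falling (INR (n0 + n)) j)
      * (zeta (RtoC (INR (n0 + n) + r + 1)) - 1) * x ^ (n0 + n))%C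
    (RtoC (/ Gamma (r + 1)) * (RtoC (Gamma (r + INR j + 1))
      * hurwitz_zeta (RtoC (r + INR j + 1)) (RtoC 2 - x) * x ^ j))%C.
Proof.
  intros Hrj Hr Hx Hn0; pose proof (pos_INR j).
  assert (HG := Gamma_pos (r + 1) ltac:(lra)).
  assert (HGj := Gamma_pos (r + INR j + 1) ltac:(lra)).
  apply (is_series_leading_zeros (V := C_NormedModule) _ _ (j - n0)).
  - intros n Hn; rewrite (falling_INR_lt (n0 + n) j) by lia.
    C_ring.
  - replace (_ * _)%C with
      (RtoC (/ Gamma (r + 1) * Gamma (r + INR j + 1)) * x ^ j
       * hurwitz_zeta (RtoC (r + INR j + 1)) (RtoC 2 - x))%C by (rewrite RtoC_mult; C_ring).
    refine (is_series_ext (V := C_NormedModule) _ _ _ _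
              (Cseries_scal _ _ _ (hurwitz_zeta_expansion (r + INR j) x Hrj Hx))).
    intros n; replace (n0 + (j - n0 + n))%nat with (j + n)%nat by lia.
    replace (INR (j + n) + r + 1) with (INR n + (r + INR j) + 1) by (rewrite plus_INR; ring).
    rewrite Cpow_add_r.
    assert (E : gbinom r (j + n) * falling (INR (j + n)) j
                = / Gamma (r + 1) * Gamma (r + INR j + 1) * gbinom (r + INR j) n).
    { pose proof (fact_INR_pos n); pose proof (fact_INR_pos (j + n)).
      unfold gbinom.
      replace (falling (INR (j + n)) j) with (INR (fact (j + n)) / INR (fact n))
        by (rewrite <- falling_INR_fact; field; lra).
      replace (INR (j + n) + r + 1) with (INR n + (r + INR j) + 1) by (rewrite plus_INR; ring).
      field; repeat split; lra. }
    rewrite <- RtoC_mult, E, !RtoC_mult; C_ring.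
Qed.

Lemma sum_n_RtoC (u : nat -> R) n :
  RtoC (sum_n u n) = @sum_n C_AbelianMonoid (fun k => RtoC (u k)) n.
Proof.
  induction n as [|n IH]; [now rewrite !sum_O|].
  rewrite sum_Sn_R, sum_Sn, RtoC_plus, IH; reflexivity.
Qed.

(** Linear combination of the series of [falling_moment_series] with
    coefficients S(p,j).  When S(p,j) = 0 the j-th series is identically zero
    whatever the value of zeta, so its convergence is not an issue. *)
Lemma stirling2_series r p x : 0 <= r -> 0 < r + INR p -> Cmod x < 2 ->
  Csums_from (first_index p)
    (fun n => RtoC (gbinom r n) * RtoC (INR n ^ p)
              * (zeta (RtoC (INR n + r + 1)) - RtoC 1) * x ^ n)%C
    (RtoC (/ Gamma (r + 1))
     * sum_n (fun j => RtoC (INR (stirling2 p j)) * RtoC (Gamma (r + INR j + 1))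
                       * hurwitz_zeta (RtoC (r + INR j + 1)) (RtoC 2 - x)
                       * x ^ j) p)%C.
Proof.
  intros Hr Hp Hx; unfold Csums_from; set (n0 := first_index p).
  set (U j n := (RtoC (gbinom r (n0 + n)) * RtoC (falling (INR (n0 + n)) j)
      * (zeta (RtoC (INR (n0 + n) + r + 1)) - 1) * x ^ (n0 + n))%C).
  set (L j := (RtoC (/ Gamma (r + 1)) * (RtoC (Gamma (r + INR j + 1))
      * hurwitz_zeta (RtoC (r + INR j + 1)) (RtoC 2 - x) * x ^ j))%C).
  assert (H : forall j, is_Cseries (fun n => RtoC (INR (stirling2 p j)) * U j n)%C
                          (RtoC (INR (stirling2 p j)) * L j)%C).
  { intros j; destruct (stirling2_first_index p j) as [E|Hj].
    - rewrite E.
      apply (is_series_ext (V := C_NormedModule) (fun n => RtoC 0 * RtoC 0)%C);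
        [intros; simpl; ring|].
      replace (RtoC (INR 0) * L j)%C with (RtoC 0 * RtoC 0)%C by (simpl; C_ring).
      apply Cseries_scal, is_Cseries_RtoC.
      change (is_lim_seq (sum_n (fun _ => 0)) 0); apply (is_lim_seq_ext (fun _ => 0)); [|apply is_lim_seq_const].
      intros n; rewrite sum_n_const; symmetry; apply Rmult_0_r.
    - apply Cseries_scal, falling_moment_series; trivial.
      destruct p as [|p]; [|destruct j as [|j]; [exfalso; simpl in Hj; lia|]].
      + simpl in Hp; pose proof (pos_INR j); lra.
      + rewrite S_INR; pose proof (pos_INR j); lra. }
  assert (HS := is_series_sum_n (V := C_NormedModule) _ _ p H).
  replace (RtoC (/ Gamma (r + 1)) * _)%C
    with (@sum_n C_AbelianMonoid (fun j => RtoC (INR (stirling2 p j)) * L j)%C p).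
  - refine (is_series_ext (V := C_NormedModule) _ _ _ _ HS).
    intros n; rewrite pow_stirling2, sum_n_RtoC.
    transitivity (RtoC (gbinom r (n0 + n)) * (zeta (RtoC (INR (n0 + n) + r + 1)) - RtoC 1) * x ^ (n0 + n)
        * @sum_n C_AbelianMonoid (fun j => RtoC (INR (stirling2 p j) * falling (INR (n0 + n)) j)) p)%C;
      [|C_ring].
    rewrite <- (sum_n_mult_l (K := C_Ring)).
    apply sum_n_ext; intros j; unfold U; rewrite RtoC_mult.
    C_ring.
  - rewrite <- (sum_n_mult_l (K := C_Ring)).
    apply sum_n_ext; intros j; unfold L.
    C_ring.
Qed.

Theorem proposition19 :
  (forall (r : R) (p : nat) (x : C),
     (0 <= r)%R -> (0 < r + INR p)%R -> (Cmod x < 2)%R ->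
     Csums_from (first_index p)
       (fun n => (RtoC (gbinom r n) * RtoC (INR n ^ p)
                  * (zeta (RtoC (INR n + r + 1)) - RtoC 1) * x ^ n)%C)
       (RtoC (/ Gamma (r + 1))
        * sum_n (fun j => RtoC (INR (stirling2 p j)) * RtoC (Gamma (r + INR j + 1))
                          * hurwitz_zeta (RtoC (r + INR j + 1)) (RtoC 2 - x)
                          * x ^ j) p)%C)
  /\
  (forall (r : R) (p : nat),
     (0 <= r)%R -> (0 < r + INR p)%R ->
     Csums_from (first_index p)
       (fun n => (RtoC (gbinom r n) * RtoC (INR n ^ p)
                  * (zeta (RtoC (INR n + r + 1)) - RtoC 1))%C)
       (RtoC (/ Gamma (r + 1))
        * sum_n (fun j => RtoC (INR (stirling2 p j)) * RtoC (Gamma (r + INR j + 1))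
                          * zeta (RtoC (r + INR j + 1))) p)%C)
  /\
  (forall (p : nat) (x : C),
     (1 <= p)%nat -> (Cmod x < 2)%R ->
     Csums_from 1
       (fun n => (RtoC (INR n ^ p) * (zeta (RtoC (INR n + 1)) - RtoC 1) * x ^ n)%C)
       (sum_n_m (fun j => RtoC (INR (stirling2 p j)) * RtoC (Gamma (INR j + 1))
                          * hurwitz_zeta (RtoC (INR j + 1)) (RtoC 2 - x)
                          * x ^ j)%C 1 p)).
Proof.
  split; [intros r p x; apply stirling2_series|split].
  - intros r p Hr Hp.
    assert (H := stirling2_series r p (RtoC 1) Hr Hp ltac:(rewrite Cmod_1; lra)).
    replace (RtoC (/ Gamma (r + 1)) * _)%C with
      (RtoC (/ Gamma (r + 1))
        * sum_n (fun j => RtoC (INR (stirling2 p j)) * RtoC (Gamma (r + INR j + 1))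
                 * hurwitz_zeta (RtoC (r + INR j + 1)) (RtoC 2 - RtoC 1) * RtoC 1 ^ j) p)%C.
    + refine (is_series_ext (V := C_NormedModule) _ _ _ _ H).
      intros n; rewrite Cpow_1_l; apply Cmult_1_r.
    + f_equal; apply sum_n_ext; intros j; rewrite Cpow_1_l, Cmult_1_r.
      unfold zeta; do 2 f_equal. rewrite <- RtoC_minus; f_equal; ring.
  - intros p x Hp Hx.
    assert (H := stirling2_series 0 p x (Rle_refl 0)).
    assert (Hp' : 0 < 0 + INR p) by (rewrite Rplus_0_l; apply lt_0_INR; lia).
    specialize (H Hp' Hx).
    destruct p as [|p]; [lia|].
    assert (HG : / Gamma (0 + 1) = 1) by (rewrite Rplus_0_l, Gamma_1; apply Rinv_1).
    rewrite HG, Cmult_1_l in H. unfold sum_n in H.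
    rewrite sum_Sn_m in H by lia.
    replace (plus _ _) with
      (@sum_n_m C_AbelianMonoid (fun j => RtoC (INR (stirling2 (S p) j)) * RtoC (Gamma (INR j + 1))
                          * hurwitz_zeta (RtoC (INR j + 1)) (RtoC 2 - x)
                          * x ^ j)%C 1 (S p)) in H.
    + refine (is_series_ext (V := C_NormedModule) _ _ _ _ H).
      intros n; rewrite !Rplus_0_r.
      assert (gbinom 0 (first_index (S p) + n) = 1) as ->; [|cbn [first_index]; C_ring].
      unfold gbinom; rewrite Rplus_0_r, Rplus_0_l, Gamma_1, Gamma_nat.
      pose proof (fact_INR_pos (first_index (S p) + n)); field; lra.
    + rewrite (sum_n_m_ext (G := C_AbelianMonoid) _ (fun j => RtoC (INR (stirling2 (S p) j)) * RtoC (Gamma (0 + INR j + 1))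
                          * hurwitz_zeta (RtoC (0 + INR j + 1)) (RtoC 2 - x)
                          * x ^ j)%C).
      * simpl (INR (stirling2 (S p) 0)); rewrite !Cmult_0_l; symmetry; apply Cplus_0_l.
      * intros j; now rewrite Rplus_0_l.
Qed.
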